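(* Let $G$ be a finite group. The following conditions are equivalent: (a) the equivalence relations $\approx$ and $\sim$ on the set $FL(G)$ of fuzzy subgroups of $G$ coincide; (b) $G$ is cyclic.
   Context: Let $G$ be a finite group. A fuzzy subgroup of $G$ is a function $\mu:G\to[0,1]$ with $\mu(xy)\ge\min\{\mu(x),\mu(y)\}$ and $\mu(x^{-1})\ge\mu(x)$ for all $x,y\in G$; $FL(G)$ denotes the set of all fuzzy subgroups of $G$. For $\alpha\in[0,1]$ put ${}_\mu G_\alpha=\{x\in G\mid \mu(x)\ge\alpha\}$. If $\mu(G)=\{\alpha_1,\dots,\alpha_r\}$ with $\alpha_1>\alpha_2>\dots>\alpha_r$, then $\mu$ determines the chain of subgroups $\mathcal{C}_\mu:\ {}_\mu G_{\alpha_1}\subset{}_\mu G_{\alpha_2}\subset\dots\subset{}_\mu G_{\alpha_r}=G$ (strict inclusions). The relation $\sim$ on $FL(G)$: $\mu\sim\eta$ iff for all $x,y\in G$, $\mu(x)>\mu(y)\Longleftrightarrow\eta(x)>\eta(y)$ (equivalently, $\mathcal{C}_\mu=\mathcal{C}_\eta$). The relation $\approx$ on $FL(G)$: $\mu\approx\eta$ iff there exists $f\in\mathrm{Aut}(G)$ with $f(\mathcal{C}_\eta)=\mathcal{C}_\mu$, i.e. the two chains have the same number of terms and $f$ maps the $i$-th term of $\mathcal{C}_\eta$ onto the $i$-th term of $\mathcal{C}_\mu$ for every $i$. *)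

(* Defs.v *)
From HB Require Import structures.
From mathcomp Require Import all_boot all_order all_algebra all_fingroup all_solvable.
From mathcomp Require Import reals.

Set Implicit Arguments.
Unset Strict Implicit.
Unset Printing Implicit Defensive.

Import Order.TTheory GRing.Theory Num.Theory.
Local Open Scope ring_scope.

(* The finite group G is the whole type gT, i.e. [set: gT]. *)
Record fuzzy_subgroup (R : realType) (gT : finGroupType) := FuzzySubgroup {
  fuzzy_fun :> gT -> R;
  fuzzy_unit_interval : forall x : gT, 0 <= fuzzy_fun x <= 1;
  fuzzy_mulg : forall x y : gT,
    Num.min (fuzzy_fun x) (fuzzy_fun y) <= fuzzy_fun (x * y)%g;
  fuzzy_invg : forall x : gT, fuzzy_fun x <= fuzzy_fun (x^-1)%g
}.

Section Fuzzy.

Variables (R : realType) (gT : finGroupType).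
Implicit Types mu eta : fuzzy_subgroup R gT.

Definition level_set mu (alpha : R) : {set gT} := [set x | alpha <= mu x].

(* The image of mu, listed without repetition as alpha_1 > ... > alpha_r. *)
Definition fuzzy_values mu : seq R := sort >=%R (undup (codom mu)).

Definition level_chain mu : seq {set gT} :=
  [seq level_set mu alpha | alpha <- fuzzy_values mu].

Definition fuzzy_sim mu eta : Prop :=
  forall x y : gT, (mu x > mu y) <-> (eta x > eta y).

(* Equality of sequences: same number of terms, and equality term by term. *)
Definition fuzzy_approx mu eta : Prop :=
  exists2 f : {perm gT}, f \in Aut [set: gT] &
    [seq f @: H | H : {set gT} <- level_chain eta] = level_chain mu.

End Fuzzy.

(* Main.v *)
(* The relation [~] means equality of level chains, so (a) holds iff every
   automorphism of G fixes every subgroup: for an automorphism f and the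
   indicator mu of a subgroup, (mu o f) is approximately equivalent to mu.
   Cyclic groups have this property.  Conversely, if all subgroups of G are
   characteristic then all Sylow subgroups are normal, so G is their direct
   product and they inherit the property.  In a p-group P, let M be a maximal
   subgroup, x an element outside M and b a central element of order p in M.
   The automorphism g |-> g h(g), with h : P -> <b> of kernel M and h(x) = b,
   fixes <x>, so b lies in <x>.  Varying M and x shows that P <> 1 has only one
   subgroup of order p, hence P is cyclic or generalized quaternion.  In the
   quaternion case, x |-> x, y |-> x y moves <y>. *)
Require Import Defs.
From HB Require Import structures.
From mathcomp Require Import all_boot all_order all_algebra all_fingroup all_solvable.
From mathcomp Require Import reals.

Set Implicit Arguments.
Unset Strict Implicit.
Unset Printing Implicit Defensive.

Import Order.TTheory GRing.Theory Num.Theory GroupScope.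

(** * Reduction to Sylow subgroups: nilpotency and direct factors *)

Definition all_char (gT : finGroupType) (G : {group gT}) : Prop :=
  forall H : {group gT}, H \subset G -> H \char G.

Lemma all_char_fixed (gT : finGroupType) (G : {group gT})
    (f : {morphism G >-> gT}) (x : gT) :
  all_char G -> 'injm f -> f @* G = G -> x \in G -> f x \in <[x]>.
Proof.
move=> chG injf imf Gx.
have /charP[sXG /(_ f injf imf) /= <-] : <[x]>%G \char G.
  by apply: chG; rewrite cycle_subG.
by rewrite mem_morphim ?cycle_id.
Qed.

Lemma all_char_normal (gT : finGroupType) (G H : {group gT}) :
  all_char G -> H \subset G -> H <| G.
Proof. by move=> chG sHG; exact/char_normal/chG. Qed.

(** Each Sylow subgroup is normal and nilpotent, so it lies in the Fitting subgroup; together they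
    generate [G]. *)
Lemma all_char_nil (gT : finGroupType) (G : {group gT}) :
  all_char G -> nilpotent G.
Proof.
move=> chG; apply: nilpotentS (Fitting_nil G).
rewrite -{1}(Sylow_gen G) gen_subG; apply/bigcupsP=> P /SylowP[p _ sylP].
apply: Fitting_max (pgroup_nil (pHall_pgroup sylP)).
exact/all_char_normal/(pHall_sub sylP).
Qed.

(** An automorphism [f] of [K] extends to [G] by the identity on [H]; the extension stabilises [L]
    and agrees with [f] there. *)
Lemma all_char_dprodl (gT : finGroupType) (G K H : {group gT}) :
  K \x H = G -> all_char G -> all_char K.
Proof.
move=> defG chG L sLK; apply/charP; split=> // f injf imf.
have [_ mKH cKH tiKH] := dprodP defG.
have defF : f @* K \x idm H @* H = G by rewrite imf im_idm.
have cfH : idm H @* H \subset 'C(f @* K).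
  by rewrite imf im_idm.
have injF : 'injm (dprodm defG cfH).
  by rewrite injm_dprodm injf injm_idm imf im_idm tiKH eqxx.
have imF : dprodm defG cfH @* G = G.
  by have [_ mF _ _] := dprodP defF; rewrite -{2}mKH morphim_dprodm // mF.
have sLG : L \subset G by rewrite (subset_trans sLK) // -(dprodW defG) mulG_subl.
have /charP[_ /(_ _ injF imF)] := chG L sLG.
by rewrite morphim_dprodml.
Qed.

(** * Groups of prime power order: a unique subgroup of order [p] *)

Lemma all_char_transvection (gT : finGroupType) (p : nat)
    (P M : {group gT}) (x b : gT) :
    prime p -> p.-group P -> all_char P -> maximal M P -> x \in P :\: M ->
    b \in M :&: 'Z(P) -> #[b] = p ->
  b \in <[x]>.
Proof.
move=> pr_p pP chP maxM /setDP[Px notMx] /setIP[Mb /centerP[Pb cPb]] ob.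
have [sMP nMP] := andP (p_maximal_normal pP maxM).
have oPM : #|P / M| = p by rewrite card_quotient ?(p_maximal_index pP maxM).
have Nx := subsetP nMP x Px.
have ntMx : coset M x != 1 by apply: contra notMx => /eqP/coset_idr->.
have PMx : coset M x \in P / M by exact: mem_quotient.
have oMx : #[coset M x] = p.
  by apply: nt_prime_order => //; apply/eqP; rewrite -order_dvdn -oPM order_dvdG.
have defPM : P / M = <[coset M x]>.
  by apply/esym/eqP; rewrite eqEcard cycle_subG PMx oPM -orderE oMx leqnn.
have Qu u : u \in P -> coset M u \in <[coset M x]>.
  by rewrite -defPM; exact: mem_quotient.
(* The generator [coset M x] of [P / M] has the same order as [b], so it may be sent to [b]; thus
   [h x = b]. *)
have dvd_b : #[b] %| #[coset M x] by rewrite ob oMx.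
pose h := eltm dvd_b \o coset M.
have hM : {in P &, {morph h : u v / u * v}}.
  move=> u v Pu Pv; rewrite /h /= morphM ?(subsetP nMP) //.
  by rewrite morphM //; exact: Qu.
have h1 u : u \in M -> h u = 1 by move=> Mu; rewrite -(morph1 (eltm_morphism dvd_b)) -(coset_id Mu).
have h_b u : u \in P -> h u \in <[b]>.
  by move=> Pu; rewrite -(im_eltm dvd_b); apply: (@mem_morphim _ _ _ (eltm_morphism dvd_b)); exact: Qu.
have cyc_comm c u : c \in <[b]> -> u \in P -> commute c u.
  by move=> /cycleP[i ->] Pu; apply/commute_sym/commuteX; rewrite /commute cPb.
have sbM : <[b]> \subset M by rewrite cycle_subG.
have fM : {in P &, {morph (fun u => u * h u) : u v / u * v}}.
  move=> u v Pu Pv /=; rewrite hM // !mulgA; congr (_ * _).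
  by rewrite -!mulgA; congr (_ * _); rewrite -cyc_comm // h_b.
pose f := Morphism fM.
have injf : 'injm f.
  apply/subsetP=> u /morphpreP[Pu /set1P fu1]; apply/set1P.
  (* From [u * h u = 1], [u^-1 = h u] lies in [<[b]>], inside [M], where [h] is trivial. *)
  have Mu : u \in M.
    rewrite -groupV (subsetP sbM) // -[u^-1]mulg1 -fu1 /= mulKg; exact: h_b.
  by rewrite -fu1 /= h1 // mulg1.
have imf : f @* P = P.
  apply/eqP; rewrite eqEcard card_injm // leqnn andbT.
  apply/subsetP=> _ /morphimP[u Pu _ ->] /=.
  by rewrite groupM // (subsetP sMP) // (subsetP sbM) // h_b.
have := all_char_fixed chP injf imf Px.
by rewrite /= groupMl ?cycle_id // /h /= eltm_id.
Qed.

(** A nontrivial normal subgroup of a nilpotent group meets the centre; for [<[b]>], prime order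
    then gives inclusion. *)
Lemma all_char_prime_center (gT : finGroupType) (p : nat)
    (P : {group gT}) (b : gT) :
  prime p -> all_char P -> b \in P -> #[b] = p -> b \in 'Z(P).
Proof.
move=> pr_p chP Pb ob; rewrite -cycle_subG.
have sbP : <[b]> \subset P by rewrite cycle_subG.
have: <[b]> :&: 'Z(P) != 1.
  apply: meet_center_nil (all_char_nil chP) (all_char_normal chP sbP) _.
  by rewrite -cardG_gt1 -orderE ob prime_gt1.
by apply: contraR => /prime_TIg-> //; rewrite -orderE ob.
Qed.

Lemma notin_Frattini (gT : finGroupType) (P : {group gT}) (x : gT) :
  x \in P -> x \notin 'Phi(P) -> exists2 M : {group gT}, maximal M P & x \notin M.
Proof.
move=> Px notPhix; have [M /andP[maxM notMx] | noM] :=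
  pickP [pred M : {group gT} | maximal M P & x \notin M]; first by exists M.
case/bigcapP: notPhix => M /orP[/eqP-> // | maxM].
by have := noM M; rewrite /= maxM => /negbFE.
Qed.

Lemma all_char_card_Ohm1 (gT : finGroupType) (p : nat) (P : {group gT}) :
  p.-group P -> P :!=: 1 -> all_char P -> #|'Ohm_1(P)| = p.
Proof.
move=> pP ntP chP; have [pr_p _ _] := pgroup_pdiv pP ntP.
have [b /and3P[Pb /eqP ob notPhib] | allPhi] :=
    pickP [pred b | [&& b \in P, #[b] == p & b \notin 'Phi(P)]].
  (* This forces [#|P| = p]: if [M] were nontrivial, it would contain some [c] of order [p], and [c
     \in <[b]>] would give [<[c]> = <[b]>], hence [b \in M]. *)
  have [M maxM notMb] := notin_Frattini Pb notPhib.
  have sMP : M \subset P by case/andP: (p_maximal_normal pP maxM).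
  have [M1 | ntM] := eqVneq (M : {set gT}) 1.
    have oP : #|P| = p.
      by rewrite -(Lagrange sMP) (p_maximal_index pP maxM) M1 cards1 mul1n.
    have cP : cyclic P by rewrite prime_cyclic ?oP.
    by apply/(prime_Ohm1P pP ntP); rewrite cP.
  have [_ pM _] := pgroup_pdiv (pgroupS sMP pP) ntM.
  have [c Mc oc] := Cauchy pr_p pM.
  have Zc := all_char_prime_center pr_p chP (subsetP sMP c Mc) oc.
  have bc : c \in <[b]>.
    apply: (all_char_transvection pr_p pP chP maxM _ _ oc); first exact/setDP.
    exact/setIP.
  have ebc : <[c]> = <[b]>.
    by apply/eqP; rewrite eqEcard cycle_subG bc -!orderE ob oc leqnn.
  by case/negP: notMb; rewrite -cycle_subG -ebc cycle_subG.
(* Now all elements of order [p] lie in ['Phi(P)], hence in every maximal subgroup, so a single [x]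
   outside ['Phi(P)] has all of them in [<[x]>]. *)
have /properP[_ [x Px notPhix]] := Phi_proper ntP.
have [M maxM notMx] := notin_Frattini Px notPhix.
have px : p.-elt x := mem_p_elt pP Px.
have ntx : <[x]> != 1.
  by rewrite cycle_eq1; apply: contraNneq notMx => ->; exact: group1.
have cx : cyclic <[x]> := cycle_cyclic x.
have oOx : #|'Ohm_1(<[x]>)| = p by apply/(prime_Ohm1P px ntx); rewrite cx.
suff <- : 'Ohm_1(<[x]>) = 'Ohm_1(P) by [].
apply/eqP; rewrite eqEsubset OhmS ?cycle_subG //.
rewrite [in X in X \subset _]Ohm1Eprime gen_subG; apply/subsetP=> b /setIdP[Pb pr_b].
have ob : #[b] = p.
  by have := pgroupP (mem_p_elt pP Pb) _ pr_b (dvdnn _); rewrite inE => /eqP.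
rewrite /= Ohm1Eprime mem_gen // inE pr_b andbT.
apply: (all_char_transvection pr_p pP chP maxM _ _ ob); first exact/setDP.
apply/setIP; split; last exact: all_char_prime_center ob.
have := allPhi b; rewrite /= Pb ob eqxx /= => /negbFE.
exact: (subsetP (Phi_sub_max maxM)).
Qed.

(** * Exclusion of the generalized quaternion groups *)

Lemma all_char_not_quaternion (gT : finGroupType) (n : nat) (G : {group gT}) :
  2 < n -> all_char G -> ~ G \isog 'Q_(2 ^ n).
Proof.
move=> n_gt2 chG isoG; have [[x y] genG _] := generators_quaternion n_gt2 isoG.
have [[_ _ invX] _ _ _ _] := quaternion_structure n_gt2 genG isoG.
have [oG Gx ox /setDP[Gy notXy]] := genG.
have [_ maxX nsX _ _] := extremal_generators_facts (isT : prime 2) genG.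
have [sXG _] := andP nsX.
have iX : #|G : <[x]>| = 2.
  by rewrite -divgS // -orderE ox oG -{1}(ltn_predK n_gt2) expnS mulnK ?expn_gt0.
have mulX u v : u \in G -> v \in G ->
    (u * v \in <[x]>) = ((u \in <[x]>) == (v \in <[x]>)).
  move=> Gu Gv; case Xu: (u \in <[x]>); first by rewrite groupMl.
  case Xv: (v \in <[x]>); first by rewrite groupMr ?Xu.
  (* By index 2, the complement of [<[x]>] is a single right coset. *)
  have: u \in <[x]> :* v^-1.
    by rewrite (rcoset_index2 sXG iX) !inE ?groupV ?Xu ?Gu ?Gv ?Xv.
  by rewrite mem_rcoset invgK => ->.
have cX u v : u \in <[x]> -> v \in <[x]> -> commute u v.
  by move=> Xu Xv; apply: (centsP (cycle_abelian x)).
(* [u |-> t u * u] is a closed form of the map fixing [x] and sending [y] to [x * y]. *)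
pose t u := if u \in <[x]> then 1 else x.
have fM : {in G &, {morph (fun u => t u * u) : u v / u * v}}.
  move=> u v Gu Gv; rewrite /= /t mulX //.
  have [Xu | notXu] := boolP (u \in <[x]>); have [Xv | notXv] := boolP (v \in <[x]>);
    rewrite /= ?mul1g ?mulgA //.
    by rewrite (cX x u) ?cycle_id.
  (* For [u], [v] outside [<[x]>]: [x u x v = u x^-1 x v = u v], as [u] inverts [x]. *)
  have ixu : x ^ u = x^-1 by apply: invX; rewrite ?cycle_id ?inE ?notXu.
  by rewrite (conjgC x u) ixu mulgKV.
pose f := Morphism fM.
have tX u : t u \in <[x]> by rewrite /t; case: ifP => _; rewrite ?group1 ?cycle_id.
have injf : 'injm f.
  apply/subsetP=> u /morphpreP[Gu /set1P fu1]; apply/set1P.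
  have Xu : u \in <[x]>.
    by rewrite -(groupMl _ (tX u)); move: fu1 => /= ->; exact: group1.
  by rewrite -fu1 /= /t Xu mul1g.
have imf : f @* G = G.
  apply/eqP; rewrite eqEcard card_injm // leqnn andbT.
  apply/subsetP=> _ /morphimP[u Gu _ ->] /=.
  by rewrite groupM // (subsetP sXG).
have := all_char_fixed chG injf imf Gy.
rewrite /= /t (negPf notXy) groupMr ?cycle_id // => /cycleP[i defx].
(* As a power of [y], [x] commutes with [y], which also inverts it; so [x] squares to 1, but its
   order [2 ^ n.-1] is at least 4. *)
have: x ^ y = x^-1 by apply: invX; rewrite ?cycle_id ?inE ?notXy.
rewrite {1}/conjg {1}defx -[y ^+ i * y]expgSr expgS mulKg -defx => /eqP.
rewrite eq_sym eq_invg_mul -expg2 -order_dvdn ox.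
by case: n n_gt2 {isoG genG ox oG iX} => [|[|[|n]]] // _; rewrite (@dvdn_Pexp2l 2 _ 1).
Qed.

Lemma all_char_cyclic (gT : finGroupType) (G : {group gT}) :
  all_char G -> cyclic G.
Proof.
move=> chG; have nilG := all_char_nil chG.
apply: nil_Zgroup_cyclic (nilG); apply/forall_inP=> P /SylowP[p _ sylP].
have [-> | ntP] := eqVneq (P : {set gT}) 1; first exact: cyclic1.
have pP := pHall_pgroup sylP.
have chP : all_char P.
  apply: all_char_dprodl chG; rewrite (nilpotent_Hall_pcore nilG sylP).
  exact: (nilpotent_pcoreC p).
have /(prime_Ohm1P pP ntP)/orP[// | /andP[_ /eqP/quaternion_classP[n n_gt2 isoP]]] :=
  all_char_card_Ohm1 pP ntP chP.
by case: (all_char_not_quaternion n_gt2 chP isoP).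
Qed.

(** * Both relations in terms of level chains *)

Section FuzzySubgroups.
Local Open Scope ring_scope.

Variables (R : realType) (gT : finGroupType).
Implicit Types (mu eta : fuzzy_subgroup R gT) (H : {set gT}).

Lemma fuzzy_values_sorted mu : sorted >%R (fuzzy_values mu).
Proof.
have: sorted <%R (rev (fuzzy_values mu)).
  rewrite lt_sorted_uniq_le rev_uniq rev_sorted sort_uniq undup_uniq.
  exact/sort_sorted/ge_total.
by rewrite rev_sorted.
Qed.

Lemma mem_fuzzy_values mu (a : R) : (a \in fuzzy_values mu) = (a \in codom mu).
Proof. by rewrite mem_sort mem_undup. Qed.

Lemma level_chainP mu H :
  reflect (exists x, H = level_set mu (mu x)) (H \in level_chain mu).
Proof.
apply: (iffP mapP) => [[a] | [x ->]].
  by rewrite mem_fuzzy_values => /codomP[x ->] ->; exists x.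
by exists (mu x); rewrite // mem_fuzzy_values codom_f.
Qed.

Lemma level_chain_sorted mu :
  sorted (fun H K : {set gT} => H \proper K) (level_chain mu).
Proof.
rewrite sorted_map; apply: sub_in_sorted (allss _) (fuzzy_values_sorted mu) => a b _.
rewrite mem_fuzzy_values => /codomP[y ->] /= lt_ya; apply/properP; split.
  by apply/subsetP=> z; rewrite !inE; apply/le_trans/ltW.
by exists y; rewrite inE ?lexx // -ltNge.
Qed.

(** The strict order that [mu] induces on points is thus recovered from its chain alone. *)
Lemma fuzzy_lt_level_chain mu (x y : gT) :
  mu y < mu x <-> exists H, [/\ H \in level_chain mu, x \in H & y \notin H].
Proof.
split=> [lt_yx | [H [/level_chainP[z ->]]]].
  exists (level_set mu (mu x)); split; first by apply/level_chainP; exists x.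
    by rewrite inE.
  by rewrite inE -ltNge.
by rewrite !inE -ltNge => le_zx /lt_le_trans->.
Qed.

Lemma fuzzy_sim_level_chain mu eta :
  fuzzy_sim mu eta <-> level_chain eta = level_chain mu.
Proof.
split=> [sim | eq_ch x y]; last by rewrite !fuzzy_lt_level_chain eq_ch.
have eq_lev x : level_set eta (eta x) = level_set mu (mu x).
  apply/setP=> y; rewrite !inE !leNgt; congr (~~ _).
  by apply/idP/idP => /sim.
(* A strictly increasing chain is determined by its set of terms. *)
apply: (irr_sorted_eq (leT := fun H K : {set gT} => H \proper K));
  rewrite ?level_chain_sorted //.
- by move=> H K L; apply: proper_trans.
- by move=> H; rewrite /= properxx.
- by move=> H; apply/level_chainP/level_chainP=> -[x ->]; exists x; rewrite eq_lev.
Qed.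

Lemma fuzzy_le1 mu (x : gT) : mu x <= mu 1%g.
Proof.
have := fuzzy_mulg mu x x^-1%g; rewrite mulgV; apply: le_trans.
by rewrite le_min lexx fuzzy_invg.
Qed.

Lemma group_set_level mu (x : gT) : group_set (level_set mu (mu x)).
Proof.
apply/group_setP; split=> [|y z]; rewrite !inE ?fuzzy_le1 // => le_y le_z.
by apply: le_trans (fuzzy_mulg mu y z); rewrite le_min le_y.
Qed.

(** Subgroups of a cyclic group are characteristic, so automorphisms fix each term of a chain. *)
Lemma cyclic_fuzzy_approx mu eta : cyclic [set: gT] ->
  fuzzy_approx mu eta <-> level_chain eta = level_chain mu.
Proof.
move=> cG; have fixE f : f \in Aut [set: gT] ->
    [seq f @: H | H : {set gT} <- level_chain eta] = level_chain eta.
  move=> Af; rewrite -[RHS]map_id; apply/eq_in_map => H /level_chainP[x ->].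
  have: group (group_set_level eta x) \char [set: gT].
    by rewrite sub_cyclic_char ?subsetT.
  move=> /andP[_ /forall_inP/(_ f Af)] sfH; apply/eqP.
  by rewrite eqEcard sfH card_imset ?leqnn //; exact: perm_inj.
split=> [[f Af] | eq_ch]; first by rewrite fixE.
by exists 1%g; rewrite ?group1 // fixE ?group1.
Qed.

(** * Test objects for the converse: indicators and pullbacks *)

Section Indicator.

Variable H : {group gT}.

Let indic (x : gT) : R := (x \in H)%:R.

Let indic_01 x : 0 <= indic x <= 1.
Proof. by rewrite ler0n lern1 leq_b1. Qed.

Let indicM x y : Num.min (indic x) (indic y) <= indic (x * y)%g.
Proof.
rewrite ge_min /indic; have [Hx | _] := boolP (x \in H); last by rewrite ler0n.
by rewrite groupMl // lexx orbT.
Qed.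

Let indicV x : indic x <= indic x^-1%g.
Proof. by rewrite /indic groupV. Qed.

Definition fuzzy_indicator := FuzzySubgroup indic_01 indicM indicV.

End Indicator.

Section Pullback.

Variables (mu : fuzzy_subgroup R gT) (f : {morphism [set: gT] >-> gT}).

Let fmu (x : gT) := mu (f x).

Let fmu_01 x : 0 <= fmu x <= 1.
Proof. exact: fuzzy_unit_interval. Qed.

Let fmuM x y : Num.min (fmu x) (fmu y) <= fmu (x * y)%g.
Proof. by rewrite /fmu morphM ?inE // fuzzy_mulg. Qed.

Let fmuV x : fmu x <= fmu x^-1%g.
Proof. by rewrite /fmu morphV ?inE // fuzzy_invg. Qed.

Definition fuzzy_pullback := FuzzySubgroup fmu_01 fmuM fmuV.

(** As [f] is onto, [mu o f] has the values of [mu], and [f] maps each of its level sets onto the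
    one of [mu] at the same value. *)
Lemma fuzzy_approx_pullback : 'injm f -> fuzzy_approx mu fuzzy_pullback.
Proof.
move=> injf; have imf : f @* [set: gT] = [set: gT].
  by apply/eqP; rewrite eqEcard subsetT card_injm ?leqnn.
exists (aut injf imf); first exact: Aut_aut.
have val_eq : fuzzy_values fuzzy_pullback = fuzzy_values mu.
  apply/perm_sortP; [exact: ge_total | exact: ge_trans | exact: ge_anti |].
  apply: uniq_perm; rewrite ?undup_uniq // => a; rewrite !mem_undup.
  apply/codomP/codomP=> [[x ->] | [y ->]]; first by exists (f x).
  have: y \in f @* [set: gT] by rewrite imf inE.
  by case/morphimP=> x _ _ ->; exists x.
rewrite /level_chain val_eq -map_comp; apply: eq_map => a /=.
apply/setP=> y; apply/imsetP/idP => [[x]|].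
  by rewrite !inE => le_a ->; rewrite autE ?inE.
rewrite inE => le_a; have: y \in f @* [set: gT] by rewrite imf inE.
by case/morphimP=> x _ _ ey; exists x; rewrite ?autE ?inE //= /fmu -ey.
Qed.

End Pullback.

End FuzzySubgroups.

Theorem theorem4p1p1 (R : realType) (gT : finGroupType) :
  (forall mu eta : fuzzy_subgroup R gT, fuzzy_approx mu eta <-> fuzzy_sim mu eta)
  <-> cyclic [set: gT].
Proof.
split=> [approxE | cG mu eta]; last first.
  by rewrite cyclic_fuzzy_approx // fuzzy_sim_level_chain.
apply: all_char_cyclic => H sHG; apply/charP; split=> // f injf _.
pose mu := fuzzy_indicator R H.
have /approxE sim := fuzzy_approx_pullback mu injf.
apply/eqP; rewrite eqEcard card_injm // leqnn andbT.
apply/subsetP=> _ /morphimP[x Gx Hx ->]; apply: contraT => notHfx.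
(* At [1] and [x] the pullback takes the values 1 and 0, while [mu] is 1 at both. *)
have [_ /(_ _)] := sim 1%g x.
by rewrite /= morph1 group1 Hx (negPf notHfx) ltxx ltr01 => /(_ isT).
Qed.
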